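(* Let $T : \ell^1(\mathbb{Z}) \to C(S^1)$ be a linear and bounded operator such that (i) (time difference property) $T(\Delta^+ f)(y) = (e^{2\pi i y} - 1)\, T(f)(y)$ for every $f\in\ell^1(\mathbb{Z})$ and every $y\in S^1$, where $\Delta^+ f(n) := f(n+1)-f(n)$ for $n\in\mathbb{Z}$; and (ii) $T(\mathbf{1}_0)(y) = 1$ for every $y\in S^1$, where $\mathbf{1}_0$ is the indicator function (sequence) of the singleton $\{0\}\subset\mathbb{Z}$. Then $T$ is the discrete-time Fourier transform, i.e. $$T(f)(y) = \sum_{n\in\mathbb{Z}} f(n) e^{-2\pi i n y}$$ for every $f\in\ell^1(\mathbb{Z})$ and $y\in S^1$.
   Context: $S^1$ is understood as the interval $[0,1]$ with addition modulo $1$ (i.e. the circle group $\mathbb{R}/\mathbb{Z}$, with $0$ and $1$ identified). $C(S^1)$ is the Banach space of complex-valued continuous functions on $S^1$ with the supremum norm, and $\ell^1(\mathbb{Z})$ is the Banach space of absolutely summable complex-valued functions on $\mathbb{Z}$. *)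

(* Defs.v *)
From HB Require Import structures.
From mathcomp Require Import all_boot all_order all_algebra.
From mathcomp Require Import complex finmap.
From mathcomp Require Import all_classical all_reals all_analysis.
From mathcomp Require summability.
Set Implicit Arguments. Unset Strict Implicit. Unset Printing Implicit Defensive.
Import Order.TTheory GRing.Theory Num.Theory.
Import numFieldNormedType.Exports.
Local Open Scope classical_set_scope.
Local Open Scope ring_scope.
Local Open Scope complex_scope.
Import Normc.
Local Open Scope quotient_scope.

(* Subgroup Z of R, as the range of _%:~R. *)
Definition Zint (R : realType) : zmodClosed R :=
  GRing.ZmodClosed.clone R (@Num.int_num_subdef R) _.

(* The circle group R/Z with the quotient topology; a real representative [x] of
   a point is injected by [\pi_(S1 R) x]. *)
Definition S1 (R : realType) : Type := quotient_topology {ideal_quot (Zint R)}.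

HB.instance Definition _ (R : realType) := Topological.on (S1 R).
HB.instance Definition _ (R : realType) := Quotient.on (S1 R).
HB.instance Definition _ (R : realType) :=
  GRing.Zmodule.copy (S1 R) {ideal_quot (Zint R)}.

Lemma S1_eqE (R : realType) (x y : R) :
  x = y %[mod S1 R] <-> x - y \is a Num.int.
Proof.
have e : (x - y \is a Num.int) = (\pi_{ideal_quot (Zint R)} x == \pi_{ideal_quot (Zint R)} y).
  exact: (@Quotient.idealrBE _ (Zint R) x y).
rewrite e; split => [xy|/eqP //].
apply/eqP. exact: xy.
Qed.

Lemma S1_piD (R : realType) (x y : R) :
  \pi_(S1 R) (x + y) = \pi_(S1 R) x + \pi_(S1 R) y.
Proof. exact: (@Quotient.pi_add _ (Zint R) x y). Qed.

Lemma S1_piN (R : realType) (x : R) : \pi_(S1 R) (- x) = - \pi_(S1 R) x.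
Proof. exact: (@Quotient.pi_opp _ (Zint R) x). Qed.

Lemma S1_piMz (R : realType) (x : R) (n : int) :
  \pi_(S1 R) (x *~ n) = \pi_(S1 R) x *~ n.
Proof.
have nat (m : nat) : \pi_(S1 R) (x *+ m) = \pi_(S1 R) x *+ m.
  elim: m => [|m IH]; last by rewrite !mulrS S1_piD IH.
  by apply: (@addIr _ (\pi_(S1 R) 0)); rewrite -S1_piD !mulr0n !add0r.
by case: n => m; rewrite ?NegzE ?mulrNz ?S1_piN -!pmulrn nat.
Qed.

Lemma S1_compact (R : realType) : compact [set: S1 R].
Proof.
have -> : [set: S1 R] = \pi_(S1 R) @` `[0, 1]%classic.
  apply/seteqP; split => // y _.
  pose x := repr y - (Num.floor (repr y))%:~R.
  exists x.
    rewrite /x /= in_itv /= subr_ge0 ge_floor lerBlDl ltW//.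
    by rewrite -[X in _ + X]/(1%:~R) -intrD floorD1_gt.
  rewrite -[RHS]reprK; apply/S1_eqE; rewrite /x.
  by rewrite addrAC subrr add0r rpredN intr_int.
apply: continuous_compact; last exact: segment_compact.
by apply: continuous_subspaceT; exact: pi_continuous.
Qed.

Lemma norm_normc (R : realType) (z : R[i]^o) : `|z| = (normc z)%:C.
Proof. by []. Qed.

Lemma normc_ge0 (R : realType) (z : R[i]) : 0 <= normc z.
Proof. by rewrite -(@lecR R) -norm_normc normr_ge0. Qed.

Lemma normc_continuous (R : realType) (T : topologicalType) (g : T -> R[i]^o) :
  continuous g -> continuous (fun y => normc (g y)).
Proof.
move=> gc y; apply/cvgrPdist_lt => e e0.
have e0C : (0 : R[i]) < e%:C by rewrite ltcR.
have /cvgrPdist_lt/(_ _ e0C) := gc y.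
apply: filterS => t gt.
rewrite -ltcR; apply: le_lt_trans gt.
have tri (u v : R[i]) : normc u - normc v <= normc (u - v).
  by rewrite lerBlDr -{1}[u](subrK v) le_normcD.
rewrite [leRHS]norm_normc lecR ler_norml lerNl opprB tri andbT.
by rewrite -[leRHS]normcN opprB tri.
Qed.

Section esumZ.
Context {R : realType} {T : choiceType}.
Local Open Scope ereal_scope.
Lemma esumZ_le (c : R) (a : T -> \bar R) : (0 <= c)%R -> (forall t, 0 <= a t) ->
  \esum_(t in setT) (c%:E * a t) <= c%:E * \esum_(t in setT) a t.
Proof.
move=> c0 a0; apply: ge_ereal_sup => _ [X [finX _]] <-.
rewrite -ge0_mule_fsumr//; apply: lee_wpmul2l; first by rewrite lee_fin.
by apply: esum_ge; exists X.
Qed.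
Lemma esumZ (c : R) (a : T -> \bar R) : (0 <= c)%R -> (forall t, 0 <= a t) ->
  \esum_(t in setT) (c%:E * a t) = c%:E * \esum_(t in setT) a t.
Proof.
move=> c0 a0; apply/eqP; rewrite eq_le esumZ_le//=.
have [->|cN0] := eqVneq c 0%R.
  by rewrite mul0e; apply: esum_ge0 => t _; rewrite mul0e.
have {cN0}c0 : (0 < c)%R by rewrite lt_neqAle eq_sym cN0.
have ci0 : (0 <= c^-1)%R by rewrite invr_ge0 ltW.
rewrite -lee_pdivlMl//.
rewrite [leLHS](_ : _ = \esum_(t in setT) (c^-1%:E * (c%:E * a t))).
  by apply: esumZ_le => // t; rewrite mule_ge0// lee_fin ltW.
by apply: eq_esum => t _; rewrite muleA -EFinM mulVf ?gt_eqF// mul1e.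
Qed.
End esumZ.

(* The codomain is [R[i]^o] rather than [R[i]]: only the former carries the norm
   topology of the complex numbers and the [R[i]]-module structure that
   [normedModType] needs. *)
Definition ell1_pred (R : realType) : {pred int -> R[i]^o} :=
  fun f => `[< summable [set: int] (fun n => (normc (f n))%:E) >].

Lemma esum_normc (R : realType) (f : int -> R[i]^o) :
  (\esum_(n in [set: int]) `|(normc (f n))%:E|
   = \esum_(n in [set: int]) (normc (f n))%:E)%E.
Proof. by apply: eq_esum => n _; rewrite gee0_abs// lee_fin normc_ge0. Qed.

Lemma ell1_submod_closed (R : realType) : submod_closed (@ell1_pred R).
Proof.
split.
  apply/asboolP; rewrite /summable esum_normc esum1// => n _.
  by rewrite normc0.
move=> a f g /asboolP + /asboolP; rewrite /summable !esum_normc => sf sg.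
apply/asboolP; rewrite /summable !esum_normc.
have nn (h : int -> R[i]^o) t : (0 <= (normc (h t))%:E)%E.
  by rewrite lee_fin normc_ge0.
apply: (@le_lt_trans _ _ (\esum_(n in [set: int])
   ((normc a)%:E * (normc (f n))%:E + (normc (g n))%:E)))%E.
  apply: le_esum => n _; rewrite -EFinM -EFinD lee_fin.
  by rewrite (le_trans (le_normcD _ _))// -normcM.
rewrite esumD//; last by move=> n _; rewrite mule_ge0// lee_fin normc_ge0.
rewrite esumZ ?normc_ge0// lte_add_pinfty// lte_mul_pinfty//.
by rewrite lee_fin normc_ge0.
Qed.
HB.instance Definition _ (R : realType) :=
  GRing.isSubmodClosed.Build R[i] _ (@ell1_pred R) (@ell1_submod_closed R).

Record ell1 (R : realType) := Ell1 {
  ell1_fun :> int -> R[i]^o;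
  _ : ell1_fun \in @ell1_pred R }.
HB.instance Definition _ (R : realType) := [isSub for @ell1_fun R].
HB.instance Definition _ (R : realType) := [Choice of ell1 R by <:].
HB.instance Definition _ (R : realType) :=
  [SubChoice_isSubLmodule of ell1 R by <:].

Definition ell1_norm (R : realType) (f : ell1 R) : R :=
  fine (\esum_(n in [set: int]) (normc (f n))%:E).

Lemma ell1_normE (R : realType) (f : ell1 R) :
  (\esum_(n in [set: int]) (normc (f n))%:E = (ell1_norm f)%:E)%E.
Proof.
case: f => f fP; rewrite /ell1_norm /=; move: fP => /asboolP.
by rewrite summableE esum_normc => /fineK ->.
Qed.

Lemma ell1_ler_normD (R : realType) (f g : ell1 R) :
  (ell1_norm (f + g))%:C <= (ell1_norm f)%:C + (ell1_norm g)%:C :> R[i].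
Proof.
rewrite -rmorphD lecR -lee_fin EFinD -!ell1_normE -esumD; last 2 first.
- by move=> n _; rewrite lee_fin normc_ge0.
- by move=> n _; rewrite lee_fin normc_ge0.
by apply: le_esum => n _; rewrite -EFinD lee_fin le_normcD.
Qed.

Lemma ell1_normrZ (R : realType) (c : R[i]) (f : ell1 R) :
  (ell1_norm (c *: f))%:C = `|c| * (ell1_norm f)%:C.
Proof.
rewrite (norm_normc c) -rmorphM; congr (_%:C); apply: EFin_inj.
rewrite EFinM -!ell1_normE -esumZ ?normc_ge0//; last first.
  by move=> n; rewrite lee_fin normc_ge0.
by apply: eq_esum => n _; rewrite -EFinM -normcM.
Qed.

Lemma ell1_normr0_eq0 (R : realType) (f : ell1 R) :
  (ell1_norm f)%:C = 0 :> R[i] -> f = 0.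
Proof.
move=> [f0]; apply: val_inj; apply/funext => n /=; apply: eq0_normc.
apply/eqP; rewrite eq_le normc_ge0 andbT -lee_fin.
rewrite -[leRHS]/((0 : R)%:E) -f0 -ell1_normE.
rewrite -[leLHS](@esum_set1 _ _ n (fun n => (normc (f n))%:E)) ?lee_fin ?normc_ge0//.
rewrite esum_mkcond; apply: le_esum => k _.
by case: ifPn; rewrite // lee_fin normc_ge0.
Qed.

(* Norms of [R[i]]-modules take their values in [R[i]], hence the injection. *)
HB.instance Definition _ (R : realType) := @Lmodule_isNormed.Build R[i] (ell1 R)
  (fun f => (ell1_norm f)%:C) (@ell1_ler_normD R) (@ell1_normrZ R)
  (@ell1_normr0_eq0 R).

Lemma ell1_diff_subproof (R : realType) (f : ell1 R) :
  (fun n => f (n + 1) - f n) \in @ell1_pred R.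
Proof.
have sf : (fun n => f (n + 1)) \in @ell1_pred R.
  apply/asboolP; rewrite /summable esum_normc.
  rewrite -(@reindex_esum _ _ _ setT setT (fun n : int => n + 1) (fun n => (normc (f n))%:E)).
    by rewrite ell1_normE ltry.
  split => // [m n _ _ /addIr//|n _].
  by exists (n - 1) => //; rewrite subrK.
by apply: (rpredB sf); case: f {sf}.
Qed.

Definition ell1_diff (R : realType) (f : ell1 R) : ell1 R :=
  Ell1 (ell1_diff_subproof f).

Lemma ell1_ind0_subproof (R : realType) :
  (fun n : int => (n == 0)%:R : R[i]^o) \in @ell1_pred R.
Proof.
apply/asboolP; rewrite /summable esum_normc.
rewrite (esumID [set 0]) ?setTI; last by move=> n _; rewrite lee_fin normc_ge0.
rewrite esum_set1 ?lee_fin ?normc_ge0// eqxx.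
rewrite esum1 ?adde0 ?ltry// => n /= /eqP/negPf ->.
by rewrite normc0.
Qed.

Definition ell1_ind0 (R : realType) : ell1 R := Ell1 (ell1_ind0_subproof R).

Definition CS1_pred (R : realType) : {pred S1 R -> R[i]^o} :=
  fun g => `[< continuous g >].

Lemma CS1_submod_closed (R : realType) : submod_closed (@CS1_pred R).
Proof.
split; first by apply/asboolP; exact: (@cst_continuous _ R[i]^o).
move=> a f g /asboolP fc /asboolP gc; apply/asboolP => y.
apply: (@cvgD _ R[i]^o _ _ _ (a *: f) g (a *: f y) (g y)) (gc y).
exact: (@cvgZ _ R[i]^o _ _ _ (fun=> a) f a (f y) (cvg_cst _) (fc y)).
Qed.
HB.instance Definition _ (R : realType) :=
  GRing.isSubmodClosed.Build R[i] _ (@CS1_pred R) (@CS1_submod_closed R).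

Record CS1 (R : realType) := CS1_of {
  CS1_fun :> S1 R -> R[i]^o;
  _ : CS1_fun \in @CS1_pred R }.
HB.instance Definition _ (R : realType) := [isSub for @CS1_fun R].
HB.instance Definition _ (R : realType) := [Choice of CS1 R by <:].
HB.instance Definition _ (R : realType) :=
  [SubChoice_isSubLmodule of CS1 R by <:].

Definition CS1_norm (R : realType) (g : CS1 R) : R :=
  sup (range (fun y => normc (g y))).

Lemma CS1_has_sup (R : realType) (g : CS1 R) :
  has_sup (range (fun y => normc (g y))).
Proof.
split; first by exists (normc (g point)), point.
have gc : continuous g by case: g => g gP; apply/asboolP.
have S10 : [set: S1 R] !=set0 by exists point.
have [c _ cmax] := compact_EVT_max S10 (@S1_compact R)
  (continuous_subspaceT (normc_continuous gc)).
by exists (normc (g c)) => _ [y _ <-]; apply: cmax; rewrite inE.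
Qed.

Lemma CS1_norm_ub (R : realType) (g : CS1 R) y : normc (g y) <= CS1_norm g.
Proof. by apply: ub_le_sup; [case: (CS1_has_sup g) | exists y]. Qed.

Lemma CS1_norm_le (R : realType) (g : CS1 R) (M : R) :
  (forall y, normc (g y) <= M) -> CS1_norm g <= M.
Proof.
move=> gM; apply: ge_sup; first by case: (CS1_has_sup g).
by move=> _ [y _ <-].
Qed.

Lemma CS1_ler_normD (R : realType) (f g : CS1 R) :
  (CS1_norm (f + g))%:C <= (CS1_norm f)%:C + (CS1_norm g)%:C :> R[i].
Proof.
rewrite -rmorphD lecR; apply: CS1_norm_le => y.
by rewrite (le_trans (le_normcD _ _))// lerD// CS1_norm_ub.
Qed.

Lemma CS1_normrZ (R : realType) (c : R[i]) (g : CS1 R) :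
  (CS1_norm (c *: g))%:C = `|c| * (CS1_norm g)%:C.
Proof.
have le (a : R[i]) (h : CS1 R) : CS1_norm (a *: h) <= normc a * CS1_norm h.
  apply: CS1_norm_le => y; rewrite [normc _]normcM.
  by rewrite ler_wpM2l ?normc_ge0// CS1_norm_ub.
rewrite (norm_normc c) -rmorphM; congr (_%:C); apply/eqP.
rewrite eq_le le /=; have [->|c0] := eqVneq c 0.
  rewrite normc0 mul0r; apply: le_trans (CS1_norm_ub _ point).
  exact: normc_ge0.
have nc0 : 0 < normc c.
  rewrite lt_neqAle normc_ge0 andbT eq_sym.
  by apply: contra_neq c0 => /eq0_normc.
rewrite -ler_pdivlMl// -normcV (le_trans _ (le _ _))//.
by rewrite scalerA mulVf// scale1r.
Qed.

Lemma CS1_normr0_eq0 (R : realType) (g : CS1 R) :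
  (CS1_norm g)%:C = 0 :> R[i] -> g = 0.
Proof.
move=> [g0]; apply: val_inj; apply/funext => y /=; apply: eq0_normc.
by apply/eqP; rewrite eq_le normc_ge0 andbT -[leRHS]g0 CS1_norm_ub.
Qed.

HB.instance Definition _ (R : realType) := @Lmodule_isNormed.Build R[i] (CS1 R)
  (fun g => (CS1_norm g)%:C) (@CS1_ler_normD R) (@CS1_normrZ R)
  (@CS1_normr0_eq0 R).

Definition cexp (R : realType) (z : R[i]) : R[i] :=
  (expR (complex.Re z))%:C * (cos (complex.Im z) +i* sin (complex.Im z)).

(* The character y |-> e^(2 pi i y) of R/Z; [e2pi_pi] shows that the choice of a
   representative is immaterial. *)
Definition e2pi (R : realType) (y : S1 R) : R[i] :=
  cexp (2 * pi%:C * 'i * (repr y)%:C).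

Lemma periodicz (U V : zmodType) (f : U -> V) (T : U) :
  periodic f T -> forall (k : int) (a : U), f (a + T *~ k) = f a.
Proof.
move=> fT [n|n] a; first exact: (periodicn fT).
by rewrite NegzE mulrNz -(periodicn fT n.+1) subrK.
Qed.

Lemma e2pi_pi (R : realType) (x : R) :
  e2pi (\pi_(S1 R) x) = cexp (2 * pi%:C * 'i * x%:C).
Proof.
have /S1_eqE/intrP[k kE] : repr (\pi_(S1 R) x) = x %[mod S1 R] by rewrite reprK.
rewrite /e2pi; have -> : repr (\pi_(S1 R) x) = x + k%:~R.
  by rewrite -kE addrC subrK.
have cexpE (r : R) : cexp (2 * pi%:C * 'i * r%:C) =
    cos (pi *+ 2 * r) +i* sin (pi *+ 2 * r).
  rewrite /cexp; set z := _ * _%:C.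
  have -> : z = 0 +i* (pi *+ 2 * r).
    rewrite /z mulr_natl -rmorphMn /=; apply/eqP; rewrite eq_complex /=.
    by rewrite !(mulr0, mul0r, mulr1, mul1r, oppr0, addr0, add0r) !eqxx.
  by rewrite /= expR0 mul1r.
rewrite !cexpE mulrDr mulrzr.
by rewrite (periodicz (@cosD2pi R)) (periodicz (@sinD2pi R)).
Qed.

Lemma e2pi_piNMz (R : realType) (x : R) (n : int) :
  e2pi (- (\pi_(S1 R) x *~ n)) = cexp (- 2 * pi%:C * 'i * n%:~R * x%:C).
Proof.
rewrite -S1_piMz -S1_piN e2pi_pi rmorphN rmorphMz /= -mulrzr; congr cexp.
by rewrite !mulrN !mulNr -!mulrA [x%:C * _]mulrC.
Qed.

(* Main.v *)
(* The difference property turns the shift f |-> f(. + 1) into multiplication by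
   e^(2 pi i y), so the value of T at the unit sequences is determined by its value
   at the one supported at 0.  The truncations of f to finite sets of indices
   converge to f in l^1, and T is continuous. *)
Require Import Defs.
From mathcomp Require Import all_boot all_order all_algebra.
From mathcomp Require Import complex finmap.
From mathcomp Require Import all_classical all_reals all_analysis.
From mathcomp Require summability.
Import Order.TTheory GRing.Theory Num.Theory.
Import numFieldNormedType.Exports.
Local Open Scope classical_set_scope.
Local Open Scope ring_scope.
Local Open Scope complex_scope.
Set Implicit Arguments.
Unset Strict Implicit.
Unset Printing Implicit Defensive.
Import Normc.
#[local] Existing Instance summability.totally_filter.

Lemma cexpD (R : realType) (z w : R[i]) : cexp (z + w) = cexp z * cexp w.
Proof.
case: z w => [a b] [c d]; rewrite /cexp /= expRD cosD sinD.
rewrite mulrACA -rmorphM /=; congr (_ * _).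
by apply/eqP; rewrite eq_complex /= eqxx addrC eqxx.
Qed.

Lemma e2piD (R : realType) (x y : S1 R) : e2pi (x + y) = e2pi x * e2pi y.
Proof.
rewrite -[x]reprK -[y]reprK -S1_piD !e2pi_pi -cexpD -mulrDr.
by congr (cexp (_ * _)); exact: rmorphD.
Qed.

Lemma e2pi0 (R : realType) : e2pi (0 : S1 R) = 1.
Proof.
rewrite -[0](subrr (\pi_(S1 R) 0)%qT) -S1_piN -S1_piD subrr e2pi_pi mulr0.
by rewrite /cexp /= expR0 cos0 sin0 mul1r.
Qed.

Lemma e2piNr (R : realType) (x : S1 R) : e2pi x * e2pi (- x) = 1.
Proof. by rewrite -e2piD subrr e2pi0. Qed.

Lemma ell1_delta_subproof (R : realType) (k : int) :
  (fun n : int => (n == k)%:R : R[i]^o) \in @ell1_pred R.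
Proof.
apply/asboolP; rewrite /summable esum_normc.
rewrite (esumID [set k]) ?setTI; last by move=> n _; rewrite lee_fin normc_ge0.
rewrite esum_set1 ?lee_fin ?normc_ge0// eqxx.
rewrite esum1 ?adde0 ?ltry// => n /= /eqP/negPf ->.
by rewrite normc0.
Qed.

Definition ell1_delta (R : realType) (k : int) : ell1 R :=
  Ell1 (@ell1_delta_subproof R k).

Lemma ell1_delta0 (R : realType) : ell1_delta R 0 = ell1_ind0 R.
Proof. exact: val_inj. Qed.

(** Since [n + 1 = k] exactly when [n = k - 1], the forward shift moves the support one step to the
    left. *)
Lemma ell1_diff_delta (R : realType) (k : int) :
  ell1_diff (ell1_delta R k) = ell1_delta R (k - 1) - ell1_delta R k.
Proof.
apply: val_inj; apply/funext => n /=.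
rewrite -[RHS]/((n == k - 1)%:R - (n == k)%:R).
by rewrite [n == k - 1]eq_sym subr_eq eq_sym.
Qed.

(** Written as a combination of unit sequences, so that linearity alone gives its image under
    [T]. *)
Definition ell1_trunc (R : realType) (f : ell1 R) (A : {fset int}) : ell1 R :=
  \sum_(k <- A) f k *: ell1_delta R k.

Lemma ell1_fun_sum (R : realType) (I : Type) (s : seq I) (F : I -> ell1 R) n :
  (\sum_(i <- s) F i) n = \sum_(i <- s) F i n.
Proof. by elim/big_rec2: _ => // i x y _ <-. Qed.

Lemma ell1_sub_truncE (R : realType) (f : ell1 R) (A : {fset int}) (n : int) :
  (f - ell1_trunc f A) n = if n \in A then 0 else f n.
Proof.
rewrite -[LHS]/(f n - ell1_trunc f A n) /ell1_trunc ell1_fun_sum.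
rewrite (eq_bigr (fun k => if k == n then f n else 0)); last first.
  move=> k _; rewrite -[LHS]/(f k * (n == k)%:R) eq_sym.
  by case: eqVneq => [->|]; rewrite ?mulr1 ?mulr0.
rewrite -big_mkcond /=; case: ifPn => nA.
  by rewrite -big_filter filter_pred1_uniq ?fset_uniq// big_seq1 subrr.
rewrite big1_seq ?subr0// => k /andP[/eqP -> kA].
by rewrite kA in nA.
Qed.

(** Both sides equal the sum of [normc (f n)] over the complement of [A]: the finite part over [A]
    cancels from the full norm. *)
Lemma ell1_norm_sub_trunc (R : realType) (f : ell1 R) (A : {fset int}) :
  ell1_norm (f - ell1_trunc f A) = ell1_norm f - \sum_(k <- A) normc (f k).
Proof.
have nn (g : ell1 R) t : (0 <= (normc (g t))%:E)%E by rewrite lee_fin normc_ge0.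
apply: EFin_inj; rewrite EFinB -!ell1_normE.
rewrite [in RHS](esumID [set` A])// !setTI.
rewrite esum_fset// fsbig_finite// set_fsetK sumEFin addrAC -EFinB subrr add0e.
rewrite [RHS]esum_mkcond; apply: eq_esum => n _.
rewrite in_setC ell1_sub_truncE.
have -> : (n \in [set` A]) = (n \in A) by apply/idP/idP; rewrite inE.
by case: ifP => // _; congr EFin; exact: normc0.
Qed.

Lemma ell1_trunc_cvg (R : realType) (f : ell1 R) :
  ell1_trunc f @ summability.totally --> f.
Proof.
apply/cvgrPdist_lt => e e0.
have eE : e = (complex.Re e)%:C by rewrite RRe_real// gtr0_real.
(* Norms take values in [R[i]], but a positive [e] is real, so the estimate can be made in [R]. *)
have {}e0 : 0 < complex.Re e by rewrite -ltcR -eE.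
have : ((ell1_norm f - complex.Re e)%:E <
    \esum_(n in [set: int]) (normc (f n))%:E)%E.
  by rewrite ell1_normE lte_fin ltrBlDr ltrDl.
(* The norm is a supremum of finite partial sums, so some finite [X] carries all but less than [e]
   of it. *)
move=> /ereal_sup_gt[_ [X [finX _] <-]].
rewrite fsbig_finite//= sumEFin lte_fin => Xf.
exists (fset_set X) => // A /= XA.
rewrite -[ltLHS]/((ell1_norm (f - ell1_trunc f A))%:C) eE ltcR.
rewrite ell1_norm_sub_trunc ltrBlDr -ltrBlDl (lt_le_trans Xf)//.
(* Enlarging [X] to [A] only adds nonnegative terms. *)
rewrite [leRHS](bigID (mem (fset_set X)))/= [X in _ <= X + _]big_mkcond/=.
rewrite -(big_fset_incl _ XA) => [|k _ /negPf -> //].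
rewrite -big_mkcond -big_seq lerDl sumr_ge0// => k _; exact: normc_ge0.
Qed.

(** The series is summed unconditionally, as a limit over the finite subsets of the integers;
    [e2pi_piNMz] identifies its characters with the usual exponentials. *)
Theorem theorem2 (R : realType) (T : {linear ell1 R -> CS1 R})
    (Tbounded : exists M : R, forall f : ell1 R, `|T f| <= M%:C * `|f|)
    (Tdiff : forall (f : ell1 R) (y : S1 R),
      T (ell1_diff f) y = (e2pi y - 1) * T f y)
    (Tind0 : forall y : S1 R, T (ell1_ind0 R) y = 1)
    (f : ell1 R) (y : S1 R) :
  summability.partial_sum (fun n : int => f n * e2pi (- (y *~ n)) : R[i]^o)
    @ summability.totally --> T f y.
Proof.
have Tdelta k : T (ell1_delta R k) y = e2pi (- (y *~ k)).
  suff u1 : T (ell1_delta R k) y * e2pi (y *~ k) = 1.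
    by rewrite -[LHS]mulr1 -(e2piNr (y *~ k)) mulrA u1 mul1r.
  (* Cancelling [T (ell1_delta R j) y] in the difference property leaves a factor [e2pi y], which
     the character absorbs: the product does not depend on [j]. *)
  have step j : T (ell1_delta R (j - 1)) y * e2pi (y *~ (j - 1)) =
      T (ell1_delta R j) y * e2pi (y *~ j).
    have := Tdiff (ell1_delta R j) y; rewrite ell1_diff_delta linearB.
    rewrite -[LHS]/(T (ell1_delta R (j - 1)) y - T (ell1_delta R j) y).
    rewrite mulrBl mul1r => /addIr ->.
    by rewrite mulrAC -e2piD mulrC -[X in X + _]mulr1z -mulrzDr addrC subrK.
  (* Induction in both directions from 0, with [step] at [k + 1] upwards and at [- k] downwards. *)
  elim: k => [|k IH|k IH].
  - by rewrite ell1_delta0 Tind0 mulr0z e2pi0 mulr1.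
  - by rewrite -step; have -> : k.+1%:Z - 1 = k by rewrite -addn1 PoszD addrK.
  - rewrite -IH -[in RHS]step.
    by have -> : - k.+1%:Z = - k%:Z - 1 by rewrite -addn1 PoszD opprD.
have Ttrunc A : summability.partial_sum
    (fun n : int => f n * e2pi (- (y *~ n)) : R[i]^o) A = T (ell1_trunc f A) y.
  rewrite /ell1_trunc linear_sum.
  have -> (F : int -> CS1 R) : (\sum_(k <- A) F k) y = \sum_(k <- A) F k y.
    by elim/big_rec2: _ => // i u v _ <-.
  rewrite /summability.partial_sum big_seq_fsetE/=; apply: eq_bigr => k _.
  by rewrite linearZ -Tdelta.
have [M TM] := Tbounded.
apply/cvgrPdist_lt => e e0.
(* [M] may be zero or negative; a positive bound is needed to divide [e] by it. *)
have M0 : 0 < (`|M| + 1)%:C by rewrite ltcR ltr_wpDl.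
have /cvgrPdist_lt/(_ _ (divr_gt0 e0 M0)) := @ell1_trunc_cvg R f.
apply: filterS => A fA; rewrite Ttrunc.
have -> : T f y - T (ell1_trunc f A) y = T (f - ell1_trunc f A) y.
  by rewrite linearB.
(* The value at [y] is controlled by the supremum norm, hence by the [ell1] norm of the
   remainder. *)
have := CS1_norm_ub (T (f - ell1_trunc f A)) y.
rewrite -lecR => /le_lt_trans; apply.
apply: le_lt_trans (TM _) _.
apply: (@le_lt_trans _ _ ((`|M| + 1)%:C * `|f - ell1_trunc f A|)).
  by rewrite ler_wpM2r// lecR (le_trans (ler_norm _))// lerDl.
by rewrite mulrC -ltr_pdivlMr.
Qed.
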